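(* Let $g_1(z),\dots,g_m(z)$ be analytic functions near $\lambda\in\mathbb C$, let $w(z)=|Wr(g_1,\dots,g_m)|$ and let $Q(z,\partial_z)$ be the differential operator $Qu=|Wr(g_1,\dots,g_m,u)|$, written as $$Q=w(z)\partial_z^m-w'(z)\partial_z^{m-1}+v(z)\partial_z^{m-2}+(\text{terms of order}\le m-3).$$ Suppose $w(\lambda)=0$ and $w'(\lambda)\ne0$. Then there exists a unique distribution of the form $c=\delta_\lambda\circ(\partial_z+\gamma)$, $\gamma\in\mathbb C$, such that $c\circ Q=0$ (i.e. $c(Qu)=0$ for every analytic $u$), and $$\gamma=\frac{v(\lambda)-w''(\lambda)}{w'(\lambda)}.$$
   Context: $Wr(v_1,\dots,v_k)$ is the $k\times k$ matrix whose first row is $(v_1,\dots,v_k)$ and each subsequent row is the $z$-derivative of the previous one; $|\cdot|$ is the determinant. $\delta_\lambda$ denotes evaluation at $z=\lambda$, so $\delta_\lambda\circ(\partial_z+\gamma)$ maps $u$ to $u'(\lambda)+\gamma u(\lambda)$. *)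

(* Defs.v *)
From HB Require Import structures.
From mathcomp Require Import all_boot all_order all_algebra.
From mathcomp Require Import all_classical all_reals all_analysis.
From mathcomp Require Import complex.
Set Implicit Arguments. Unset Strict Implicit. Unset Printing Implicit Defensive.
Import Order.TTheory GRing.Theory Num.Theory.
Import numFieldNormedType.Exports.
Local Open Scope ring_scope.
Local Open Scope complex_scope.
Local Open Scope classical_set_scope.

(* the complex field as a numFieldType (so that it carries its normed/topological
   structure from MathComp-Analysis) *)
Notation CC R := ((R : realType)[i] : numFieldType) (only parsing).

Section Wronskian.
Variable R : realType.
Local Notation C := (CC R).

Definition analytic_near (f : C -> C) (lam : C) : Prop :=
  exists r : R, (0 < r)%R /\ exists a : nat -> C,
    forall z : C, `|z - lam| < r%:C ->
      (fun n => \sum_(0 <= k < n) a k * (z - lam) ^+ k) @ \oo --> f z.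

Definition Wr (k : nat) (v : 'I_k -> C -> C) (z : C) : 'M[C]_k :=
  \matrix_(i < k, j < k) derive1n i (v j) z.

Definition wronskian (m : nat) (g : 'I_m -> C -> C) (z : C) : C :=
  \det (Wr g z).

Definition ext_fam (m : nat) (g : 'I_m -> C -> C) (u : C -> C) :
  'I_m.+1 -> C -> C :=
  fun j => match unlift ord_max j with Some i => g i | None => u end.

Definition Qop (m : nat) (g : 'I_m -> C -> C) (u : C -> C) (z : C) : C :=
  \det (Wr (ext_fam g u) z).

(* coefficient of d_z^k in Q (expansion of the determinant along the last
   column, whose entries are u, u', ..., u^(m)); zero if k > m. *)
Definition Qcoef (m : nat) (g : 'I_m -> C -> C) (k : nat) (z : C) : C :=
  match ltnP k m.+1 with
  | LtnNotGeq hk => cofactor (Wr (ext_fam g (fun _ => 0)) z) (Ordinal hk) ord_max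
  | _ => 0
  end.

(* v(z): coefficient of d_z^(m-2) in Q (zero when m < 2, as there is
   then no such term). *)
Definition vcoef (m : nat) (g : 'I_m -> C -> C) (z : C) : C :=
  if (2 <= m)%N then Qcoef g (m - 2) z else 0.

End Wronskian.

(* Main.v *)
Require Import Defs.
From HB Require Import structures.
From mathcomp Require Import all_boot all_order all_algebra.
From mathcomp Require Import all_classical all_reals all_analysis.
From mathcomp Require Import fingroup perm zify complex ring.
Import Order.TTheory GRing.Theory Num.Theory.
Import numFieldNormedType.Exports.
Local Open Scope ring_scope.

(* If [w lam = 0], some nonzero column [c] is killed by [Wr g lam], so all
   derivatives of [h = \sum_j c_j g_j] of order less than [m] vanish at [lam].
   The values [Qu lam] and [(Qu)' lam] are determinants whose rows agree except
   the last one (orders [m] and [m+1]); multiplying them by [c] leaves only the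
   last entry, and Cramer's rule gives [(Qu)' lam / Qu lam = h^(m+1) lam / h^(m)
   lam] independently of [u], where [h^(m) lam] is nonzero because [w' lam] is.
   Hence [gamma] exists; testing with [u = (z - lam)^(m-1)] reads off its value.
   Differentiability of all the functions involved comes from termwise
   differentiation of power series. *)

Set Implicit Arguments.
Unset Strict Implicit.
Unset Printing Implicit Defensive.

(** * Estimates for power series *)

(** By Pascal's rule the sum for [j.+1] up to [n.+1] is [q] times the sums for [j] and [j.+1] up to
    [n]. With [t = (1 - q)^-1] the induction bound is [(t^(j+2) + t^(j+1)) (1 - 1/t) = t^(j+2) -
    t^j], below the target. *)
Lemma sum_binomial_geometric_le (K : numFieldType) (q : K) (n j : nat) :
  0 <= q -> q < 1 ->
  \sum_(0 <= k < n) 'C(k, j)%:R * q ^+ k <= (1 - q)^-1 ^+ j.+1.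
Proof.
move=> q0 q1; have p0 : 0 < 1 - q by rewrite subr_gt0.
elim: n j => [|n IH] j; first by rewrite big_nil exprn_ge0// invr_ge0 ltW.
rewrite big_nat_recl //; case: j => [|j].
  rewrite bin0 expr0 mulr1.
  under eq_bigr do rewrite bin0 exprSr mulrA.
  rewrite -mulr_suml; move: (IH 0%N); under eq_bigr do rewrite bin0.
  rewrite !expr1 => /(ler_wpM2r q0) H; rewrite [leRHS](_ : _ = 1 + (1 - q)^-1 * q).
    by rewrite lerD2l.
  by field; rewrite gt_eqF.
rewrite bin0n mul0r add0r.
under eq_bigr do rewrite binS natrD mulrDl exprSr !mulrA.
rewrite big_split /= -!mulr_suml -mulrDl.
have H1 := IH j; have H2 := IH j.+1.
have /(ler_wpM2r q0) H := lerD H2 H1; apply: (le_trans H).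
rewrite -subr_ge0.
set t := (1 - q)^-1; have -> : q = 1 - t^-1 by rewrite invrK opprB addrC subrK.
have t0 : 0 < t by rewrite invr_gt0.
suff -> : t ^+ j.+2 - (t ^+ j.+2 + t ^+ j.+1) * (1 - t^-1) = t ^+ j.
  by rewrite exprn_ge0 // ltW.
by rewrite !exprS; field; rewrite gt_eqF.
Qed.

Lemma cvgn_norm_le (K : numFieldType) (u : nat -> K) (l b : K) :
  (u @ \oo --> l)%classic -> (forall n, `|u n| <= b) -> `|l| <= b.
Proof.
move=> ul ub; apply/ler_addgt0Pr => e e0.
have [N _ /(_ N (leqnn N)) /= H] := cvgr_dist_le _ _ ul _ e0.
rewrite -(subrK (u N) l) (le_trans (ler_normD _ _)) // addrC.
exact: lerD.
Qed.

(** The remainders satisfy [D_(k+1) = (w + h) D_k + k h^2 w^(k-1)], which matches Pascal's rule for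
    ['C(k, 2)]. The factor [rho ^+ 2] on the left avoids the exponent [k - 2]. *)
Lemma taylor2_pow_le (K : numFieldType) (w h rho : K) (k : nat) :
  `|w| <= rho -> `|w + h| <= rho ->
  `|(w + h) ^+ k - w ^+ k - k%:R * h * w ^+ k.-1| * rho ^+ 2
    <= 'C(k, 2)%:R * rho ^+ k * `|h| ^+ 2.
Proof.
move=> wr whr; have r0 : 0 <= rho := le_trans (normr_ge0 _) wr.
elim: k => [|k IH].
  by rewrite !expr0 subrr !mul0r subr0 normr0 mul0r.
move: IH; set D := (X in `|X| * _ <= _ -> _) => IH.
have -> : (w + h) ^+ k.+1 - w ^+ k.+1 - k.+1%:R * h * w ^+ k.+1.-1 =
    (w + h) * D + k%:R * (h ^+ 2 * w ^+ k.-1).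
  by rewrite /D {IH D}; case: k => [|k] /=; rewrite ?exprS; ring.
rewrite binS bin1 natrD 2![in leRHS]mulrDl.
apply: le_trans (_ : (`|(w + h) * D| + `|k%:R * (h ^+ 2 * w ^+ k.-1)|) * rho ^+ 2 <= _).
  by apply: ler_wpM2r; [exact: exprn_ge0|exact: ler_normD].
rewrite [leLHS]mulrDl lerD //.
  rewrite normrM -[leLHS]mulrA.
  have -> : 'C(k, 2)%:R * rho ^+ k.+1 * `|h| ^+ 2 =
      rho * ('C(k, 2)%:R * rho ^+ k * `|h| ^+ 2) by rewrite exprS; ring.
  by rewrite ler_pM ?mulr_ge0 ?exprn_ge0 ?normr_ge0.
case: k {IH D} => [|k]; first by rewrite !mul0r normr0 mul0r.
rewrite !normrM !normrX normr_nat /=.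
have -> : k.+1%:R * rho ^+ k.+2 * `|h| ^+ 2 =
   k.+1%:R * (`|h| ^+ 2 * rho ^+ k) * rho ^+ 2 by rewrite !exprS; ring.
rewrite ler_wpM2r ?exprn_ge0 // ler_wpM2l ?ler0n // ler_wpM2l ?exprn_ge0 //.
by rewrite lerXn2r ?nnegrE.
Qed.

(** Each term is a difference of consecutive partial sums, and these are bounded because they
    converge. *)
Lemma cvg_terms_le (K : numFieldType) (a : nat -> K) (x l : K) :
  0 < x ->
  ((fun n => \sum_(0 <= k < n) a k * x ^+ k) @ \oo --> l)%classic ->
  exists2 M : K, 0 <= M & forall k, `|a k| <= M * x^-1 ^+ k.
Proof.
move=> x0 cv.
have [B HB] : exists B : K, forall n, `|\sum_(0 <= k < n) a k * x ^+ k| <= B.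
  have /cvg_seq_bounded : cvgn (fun n => \sum_(0 <= k < n) a k * x ^+ k).
    exact: cvgP cv.
  have pf : ProperFilter (globally [set: nat]%classic).
    exact: (@globally_properfilter _ _ 0%N).
  by move=> /(@ex_bound _ _ _ _ _ pf) [B HB]; exists B => n; exact: HB.
exists (B + B) => [|k].
  by rewrite addr_ge0 // (le_trans (normr_ge0 _) (HB 0%N)).
rewrite exprVn ler_pdivlMr ?exprn_gt0 //.
rewrite -[X in _ * X](ger0_norm (exprn_ge0 k (ltW x0))) -normrM.
have -> : a k * x ^+ k =
    \sum_(0 <= k < k.+1) a k * x ^+ k - \sum_(0 <= k < k) a k * x ^+ k.
  by rewrite big_nat_recr //= addrAC subrr add0r.
by rewrite (le_trans (ler_normB _ _)) // lerD.
Qed.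

(** * Termwise differentiation of power series *)

Lemma is_derive_quadratic (K : numFieldType) (f : K -> K) (z l B d : K) :
  0 < d ->
  (forall h, `|h| < d -> `|f (z + h) - f z - h * l| <= B * `|h| ^+ 2) ->
  is_derive z 1 f l.
Proof.
move=> d0 H.
have H' : ((fun h => h^-1 *: ((f \o shift z) (h *: 1) - f z)) @ 0^' --> l)%classic.
  apply/cvgrPdist_le => e e0.
  have B0 : 0 <= `|B| + 1 by rewrite addr_ge0.
  have B1 : 0 < `|B| + 1 by rewrite ltr_wpDl.
  near=> h.
  have h0 : h != 0 by near: h; exact: nbhs_dnbhs_neq.
  have hd : `|h| < d by near: h; exact: dnbhs0_lt.
  have he : `|h| < e / (`|B| + 1).
    by near: h; apply: dnbhs0_lt; rewrite divr_gt0.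
  have -> : l - h^-1 *: ((f \o shift z) (h *: 1) - f z) =
      - (h^-1 * (f (z + h) - f z - h * l)).
    rewrite /= -[h *: 1]/(h * 1) mulr1 -[_ *: _]/(_ * _) (addrC h z).
    by field.
  rewrite normrN normrM normfV ler_pdivrMl ?normr_gt0 // (le_trans (H _ hd)) //.
  (* [B] is an arbitrary element of [K]; the product is real because it dominates a norm. *)
  have HB : B * `|h| ^+ 2 \is Num.real.
    by apply: ger0_real; apply: le_trans (H _ hd).
  rewrite (le_trans (real_ler_norm HB)) // normrM normrX normr_id.
  rewrite expr2 mulrCA ler_wpM2l // (@le_trans _ _ ((`|B| + 1) * `|h|)) //.
    by rewrite ler_wpM2r // lerDl.
  by rewrite mulrC -ler_pdivlMr // ltW.
split; first exact: cvgP H'.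
exact: cvg_lim H'.
Unshelve. all: by end_near. Qed.

(** The coefficients are [O(x^-k)] and the second-order Taylor remainder of the [k]-th power is at
    most ['C(k, 2) rho^(k-2) |h|^2]. Since [rho < x], the remainders sum to [O(|h|^2)]. *)
Lemma pseries_is_derive (K : numFieldType) (a : nat -> K) (f : K -> K)
    (c r z l : K) :
  (forall z, `|z - c| < r ->
    ((fun n => \sum_(0 <= k < n) a k * (z - c) ^+ k) @ \oo --> f z)%classic) ->
  `|z - c| < r ->
  ((fun n => \sum_(0 <= k < n) k.+1%:R * a k.+1 * (z - c) ^+ k) @ \oo
     --> l)%classic ->
  is_derive z 1 f l.
Proof.
move=> fE; set w := z - c => wr lE.
(* [|w| < rho < x < r]: [rho] leaves room for the increment [h], and the series still converges at
   [x]. *)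
pose rho := (`|w| + r) / 2; pose x := (rho + r) / 2.
have wrho : `|w| < rho by rewrite midf_lt.
have rhor : rho < r by rewrite midf_lt.
have rhox : rho < x by rewrite midf_lt.
have xr : x < r by rewrite midf_lt.
have rho0 : 0 < rho := le_lt_trans (normr_ge0 _) wrho.
have x0 : 0 < x := lt_trans rho0 rhox.
have [M M0 HM] : exists2 M : K, 0 <= M & forall k, `|a k| <= M * x^-1 ^+ k.
  apply: (@cvg_terms_le _ _ _ (f (c + x)) x0).
  by have := fE (c + x); rewrite addrAC subrr add0r gtr0_norm //; apply.
pose q := rho / x.
have q0 : 0 <= q by rewrite divr_ge0 // ltW.
have q1 : q < 1 by rewrite ltr_pdivrMr // mul1r.
pose B := rho ^- 2 * (M * (1 - q)^-1 ^+ 3).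
apply: (@is_derive_quadratic _ _ _ _ B (rho - `|w|)); first by rewrite subr_gt0.
move=> h hd.
have whr : `|w + h| <= rho.
  by rewrite (le_trans (ler_normD _ _)) // addrC -lerBrDr ltW.
pose u n := \sum_(0 <= k < n) a k * ((w + h) ^+ k - w ^+ k - k%:R * h * w ^+ k.-1).
(* The derived series has one term fewer, since the term [k = 0] contributes nothing to it; hence
   the shift to [n.+1]. *)
have uS n : u n.+1 = \sum_(0 <= k < n.+1) a k * (w + h) ^+ k -
    \sum_(0 <= k < n.+1) a k * w ^+ k -
    h * \sum_(0 <= k < n) k.+1%:R * a k.+1 * w ^+ k.
  rewrite /u -sumrB mulr_sumr.
  have -> : \sum_(0 <= k < n) h * (k.+1%:R * a k.+1 * w ^+ k) =
      \sum_(0 <= k < n.+1) a k * (k%:R * h * w ^+ k.-1).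
    rewrite [RHS]big_nat_recl //= !mul0r mulr0 add0r.
    by apply: eq_bigr => k _; ring.
  by rewrite -sumrB; apply: eq_bigr => k _; rewrite !mulrBr.
have ucv : ((fun n => u n.+1) @ \oo --> f (z + h) - f z - h * l)%classic.
  under eq_fun do rewrite uS.
  apply: cvgB; last by apply: cvgM => //; exact: cvg_cst.
  apply: cvgB.
    have := fE (z + h); rewrite addrAC => /(_ (le_lt_trans whr rhor)).
    by rewrite -[X in X -> _]cvg_shiftS.
  by have := fE z wr; rewrite -[X in X -> _]cvg_shiftS.
apply: (cvgn_norm_le ucv) => n.
rewrite -(ler_pM2l (exprn_gt0 2 rho0)).
have -> : rho ^+ 2 * (B * `|h| ^+ 2) = M * ((1 - q)^-1 ^+ 3) * `|h| ^+ 2.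
  by rewrite /B !mulrA mulfV ?mul1r // expf_neq0 // gt_eqF.
apply: (@le_trans _ _
    (M * (\sum_(0 <= k < n.+1) 'C(k, 2)%:R * q ^+ k) * `|h| ^+ 2)); last first.
  by rewrite ler_wpM2r ?exprn_ge0 // ler_wpM2l // sum_binomial_geometric_le.
rewrite mulr_sumr mulr_suml.
apply: le_trans (ler_wpM2l (exprn_ge0 _ (ltW rho0)) (ler_norm_sum _ _ _)) _.
rewrite mulr_sumr; apply: ler_sum => k _.
rewrite normrM mulrCA [_ ^+ 2 * _]mulrC.
apply: le_trans (ler_wpM2l (normr_ge0 _) (taylor2_pow_le _ (ltW wrho) whr)) _.
rewrite !mulrA; do 2![apply: ler_wpM2r => //]; rewrite /q [(rho / x) ^+ k]exprMn.
rewrite [leRHS](_ : _ = M * x^-1 ^+ k * 'C(k, 2)%:R * rho ^+ k); last first.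
  by rewrite [rho ^+ k * _]mulrC mulrA (mulrAC M).
by do 2![apply: ler_wpM2r; rewrite ?ler0n ?exprn_ge0 ?(ltW rho0) //].
Qed.

(* Bounded sums of norms instead of convergence, since [K] need not be complete.
   *)
Lemma pseries_diffs_norm_bounded (K : numFieldType) (a : nat -> K) (x w l : K) :
  `|w| < x ->
  ((fun n => \sum_(0 <= k < n) a k * x ^+ k) @ \oo --> l)%classic ->
  exists B : K, forall n,
    \sum_(0 <= k < n) `|k.+1%:R * a k.+1 * w ^+ k| <= B.
Proof.
move=> wx cv; have x0 : 0 < x := le_lt_trans (normr_ge0 _) wx.
have [M M0 HM] := @cvg_terms_le _ _ _ _ x0 cv.
pose q := `|w| / x.
have q0 : 0 <= q by rewrite divr_ge0 // ltW.
have q1 : q < 1 by rewrite ltr_pdivrMr // mul1r.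
(* As [k.+1 = 'C(k, 0) + 'C(k, 1)], the geometric bounds for [j = 0] and [j = 1] are added. *)
exists (M / x * ((1 - q)^-1 ^+ 1 + (1 - q)^-1 ^+ 2)) => n.
have H0 := @sum_binomial_geometric_le _ q n 0 q0 q1.
have H1 := @sum_binomial_geometric_le _ q n 1 q0 q1.
have := lerD H0 H1; rewrite -big_split /= => H.
apply: le_trans (ler_wpM2l (divr_ge0 M0 (ltW x0)) H).
rewrite mulr_sumr; apply: ler_sum => k _.
rewrite bin0 bin1 -mulrDl -natrD add1n !normrM normr_nat normrX.
have -> : M / x * (k.+1%:R * q ^+ k) = k.+1%:R * (M * x^-1 ^+ k.+1) * `|w| ^+ k.
  by rewrite /q exprMn exprS; ring.
by rewrite ler_wpM2r ?exprn_ge0 // ler_wpM2l.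
Qed.

(** * Absolutely convergent complex series *)

Lemma is_cvg_series_norm_bounded (R : realType) (v : nat -> R) (B : R) :
  (forall n, \sum_(0 <= k < n) `|v k| <= B) -> cvgn (series v).
Proof.
move=> vB; apply: normed_cvg; apply: nondecreasing_is_cvgn.
  by apply: nondecreasing_series => n _ _; exact: normr_ge0.
by exists B => _ [n _ <-]; exact: vB.
Qed.

Lemma normc_i (R : rcfType) : `|'i%C : R[i]| = 1.
Proof. by rewrite normc_def /= expr0n /= expr1n add0r sqrtr1. Qed.

Lemma normc_ge_Im (R : rcfType) (z : R[i]) : (`|complex.Im z|%:C)%C <= `|z|.
Proof.
rewrite -normrN -ReiNIm (le_trans (normc_ge_Re _)) //.
by rewrite normrM normc_i mulr1.
Qed.

Lemma complex_norm_le_sum (R : rcfType) (z : R[i]) :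
  `|z| <= (`|complex.Re z| + `|complex.Im z|)%:C%C.
Proof.
rewrite [z in leLHS]complexE (le_trans (ler_normD _ _)) // normrM.
by rewrite normc_i mul1r !normc_def /= !expr0n /= !addr0 !sqrtr_sqr rmorphD.
Qed.

(* Stated for an abstract field because canonical structure inference on the
   carrier [R[i]] does not find its normed structure. *)
Lemma numField_cvgn (K : numFieldType) (s : nat -> K) (l : K) :
  (forall e, 0 < e -> \forall n \near \oo, `|l - s n| < e)%classic ->
  (s @ \oo --> l)%classic.
Proof. by move=> H; apply/cvgrPdist_lt. Qed.

(** Real and imaginary parts are bounded by the modulus, so both real series converge absolutely. *)
Lemma cvg_complex_series_norm_bounded (R : realType) (u : nat -> CC R)
    (B : CC R) :
  (forall n, \sum_(0 <= k < n) `|u k| <= B) ->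
  exists l : CC R, ((fun n => \sum_(0 <= k < n) u k) @ \oo --> l)%classic.
Proof.
move=> uB.
have reB (p : R[i] -> R) : (forall x, (`|p x|%:C)%C <= `|x|) ->
    cvgn (series (fun k => p (u k))).
  move=> pn; apply: (@is_cvg_series_norm_bounded _ _ (complex.Re B)) => n.
  suff: ((\sum_(0 <= k < n) `|p (u k)|)%:C)%C <= (B : R[i]).
    by rewrite lecE => /andP[].
  apply: le_trans (uB n); rewrite rmorph_sum /=.
  by apply: ler_sum => k _; exact: pn.
have /cvg_ex[a /= ha] := reB _ (@normc_ge_Re R).
have /cvg_ex[b /= hb] := reB _ (@normc_ge_Im R).
pose l : CC R := (a +i* b)%C; exists l; apply: (@numField_cvgn (CC R)) => e e0.
(* A positive element of [R[i]] has zero imaginary part. *)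
have [e' e'0 ee] : exists2 e' : R, 0 < e' & e = (e'%:C)%C.
  exists (complex.Re e); first by move: e0; rewrite ltcE => /andP[].
  by rewrite RRe_real // gtr0_real.
have e2 : 0 < e' / 2 by rewrite divr_gt0.
have {}ha := cvgr_dist_lt _ _ ha _ e2; have {}hb := cvgr_dist_lt _ _ hb _ e2.
near=> n.
apply: le_lt_trans (complex_norm_le_sum _) _.
rewrite ee ltcR [ltRHS]splitr !raddfB /=.
rewrite [complex.Re (\sum_(_ <= _ < _) _)]raddf_sum.
rewrite [complex.Im (\sum_(_ <= _ < _) _)]raddf_sum.
apply: ltrD; near: n; [exact: ha|exact: hb].
Unshelve. all: by end_near. Qed.

(** * Derivatives of analytic functions *)

Definition pseries_on (R : realType) (f : CC R -> CC R) (lam : CC R) (r : R)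
    (a : nat -> CC R) :=
  forall z : CC R, `|z - lam| < (r%:C)%C ->
    ((fun n => \sum_(0 <= k < n) a k * (z - lam) ^+ k) @ \oo --> f z)%classic.

Lemma pseries_on_derive1 (R : realType) (f : CC R -> CC R) (lam : CC R) (r : R)
    (a : nat -> CC R) : pseries_on f lam r a ->
  (forall z : CC R, `|z - lam| < (r%:C)%C -> derivable f z 1) /\
  pseries_on (derive1 f) lam r (fun k => k.+1%:R * a k.+1).
Proof.
move=> fa.
suff H z : `|z - lam| < (r%:C)%C -> exists2 l, is_derive z 1 f l &
    ((fun n => \sum_(0 <= k < n) k.+1%:R * a k.+1 * (z - lam) ^+ k) @ \oo
       --> l)%classic.
  split=> z zr; have [l df cl] := H z zr; first exact: ex_derive.
  by rewrite derive1E derive_val.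
(* Convergence at the intermediate radius [x] bounds the derived series at [z] absolutely, hence
   makes it converge. *)
move=> zr; pose x := (`|z - lam| + (r%:C)%C) / 2.
have zx : `|z - lam| < x by rewrite midf_lt.
have xr : x < (r%:C)%C by rewrite midf_lt.
have x0 : 0 <= x := ltW (le_lt_trans (normr_ge0 _) zx).
have cx : ((fun n => \sum_(0 <= k < n) a k * x ^+ k) @ \oo --> f (lam + x))%classic.
  by have := fa (lam + x); rewrite addrAC subrr add0r ger0_norm //; apply.
have [B HB] := pseries_diffs_norm_bounded zx cx.
have [l cl] := cvg_complex_series_norm_bounded HB.
exists l; last exact: cl.
exact: (@pseries_is_derive (CC R) a f lam (r%:C)%C z l fa zr cl).
Qed.

(** Termwise differentiation keeps the radius [r], so one disc serves all orders [n]. *)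
Lemma analytic_near_derivable (R : realType) (f : CC R -> CC R) (lam : CC R) :
  analytic_near f lam ->
  \forall z \near lam, forall n, derivable (derive1n n f) z 1.
Proof.
move=> [r [r0 [a fa]]].
have [b fb] : exists b : nat -> nat -> CC R,
    forall n, pseries_on (derive1n n f) lam r (b n).
  suff H n : exists b, pseries_on (derive1n n f) lam r b.
    by have [b] := choice H; exists b.
  elim: n => [|n [b IH]]; first by exists a.
  by exists (fun k => k.+1%:R * b k.+1); have [] := pseries_on_derive1 IH.
have r0' : 0 < (r%:C)%C by rewrite ltcR.
near=> z; move=> n; have [+ _] := pseries_on_derive1 (fb n).
apply; rewrite distrC; near: z; exact: (@nbhsx_ballx _ _ lam _ r0').
Unshelve. all: by end_near. Qed.

(** * Derivatives of Wronskian-type determinants *)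

Section GeneralizedWronskian.
Variable K : numFieldType.
Implicit Types (z : K) (s : nat -> nat).

Lemma is_derive_fsum (I : Type) (r : seq I) (f : I -> K -> K) (df : I -> K) z :
  (forall i, is_derive z 1 (f i) (df i)) ->
  is_derive z 1 (fun t => \sum_(i <- r) f i t) (\sum_(i <- r) df i).
Proof.
move=> H; elim: r => [|i r IH].
  by under eq_fun do rewrite big_nil; rewrite big_nil; exact: is_derive_cst.
by under eq_fun do rewrite big_cons; rewrite big_cons; exact: is_deriveD.
Qed.

Lemma is_derive_fprod n (f : 'I_n -> K -> K) (df : 'I_n -> K) z :
  (forall i, is_derive z 1 (f i) (df i)) ->
  is_derive z 1 (fun t => \prod_(i < n) f i t)
    (\sum_(i < n) \prod_(j < n) if j == i then df j else f j z).
Proof.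
elim: n f df => [|n IH] f df H.
  by under eq_fun do rewrite big_ord0; rewrite big_ord0; exact: is_derive_cst.
under eq_fun do rewrite big_ord_recl.
have H1 := is_deriveM (H ord0) (IH _ _ (fun i => H (lift ord0 i))).
apply: is_derive_eq; rewrite [RHS]big_ord_recl [RHS]addrC; congr (_ + _).
  rewrite -[_ *: _]/(_ * _) mulr_sumr; apply: eq_bigr => i _.
  by rewrite big_ord_recl (negbTE (neq_lift _ _)); congr (_ * _).
by rewrite big_ord_recl eqxx -[_ *: _]/(_ * _) mulrC; congr (_ * _).
Qed.

(** In the Leibniz formula, the sum over permutations is exchanged with the sum over the row being
    differentiated. *)
Lemma is_derive_det n (A : K -> 'M[K]_n) (dA : 'M[K]_n) z :
  (forall i j, is_derive z 1 (fun t => A t i j) (dA i j)) ->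
  is_derive z 1 (fun t => \det (A t))
    (\sum_(k < n) \det (\matrix_(i, j) if i == k then dA i j else A z i j)).
Proof.
move=> H.
have H1 : is_derive z 1 (fun t => \det (A t)) (\sum_(p : 'S_n) (-1) ^+ p *
    \sum_(k < n) \prod_(i < n) if i == k then dA i (p i) else A z i (p i)).
  apply: (is_derive_fsum (index_enum 'S_n)) => p.
  exact: is_deriveZ (is_derive_fprod (fun i => H i (p i))).
apply: is_derive_eq; under eq_bigr do rewrite mulr_sumr.
rewrite exchange_big /=; apply: eq_bigr => k _; apply: eq_bigr => p _.
by congr (_ * _); apply: eq_bigr => i _; rewrite mxE.
Qed.

(* Wronskian matrix whose row [i] consists of derivatives of order [s i]; [s =
   id] is the usual one. *)
Definition gwr n s (v : 'I_n -> K -> K) z : 'M[K]_n :=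
  \matrix_(i < n, j < n) derive1n (s i) (v j) z.

Definition smooth_at z (f : K -> K) := forall k, derivable (derive1n k f) z 1.

(** The orders after differentiating row [i] once more. For size [p.+1], [incr id p] gives
    0,...,p-1,p+1; [incr (incr id p) p] gives 0,...,p-1,p+2; and, for p > 0, [incr (incr id p) p.-1]
    gives 0,...,p-2,p,p+1. *)
Definition incr s (i k : nat) : nat := (s k + (k == i))%N.

Lemma is_derive_gwr n s (v : 'I_n -> K -> K) z :
  (forall j, smooth_at z (v j)) ->
  is_derive z 1 (fun t => \det (gwr s v t))
    (\sum_(k < n) \det (gwr (incr s k) v z)).
Proof.
move=> vz.
have H i j : is_derive z 1 (fun t => gwr s v t i j)
    ((\matrix_(i < n, j < n) derive1n (s i).+1 (v j) z) i j).
  under eq_fun do rewrite mxE; rewrite mxE derive1nS derive1E.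
  by split; [exact: vz|].
have := is_derive_det H; congr is_derive; apply: eq_bigr => k _.
congr (\det _); apply/matrixP => i j; rewrite !mxE /incr -(inj_eq val_inj) /=.
by case: eqVneq; rewrite ?addn1 ?addn0.
Qed.

Lemma gwr_dup n s (v : 'I_n -> K -> K) z (i j : 'I_n) :
  i != j -> s i = s j -> \det (gwr s v z) = 0.
Proof.
by move=> ij sij; apply: (determinant_alternate ij) => k; rewrite !mxE sij.
Qed.

(** Raising the order of a row [i < p] makes it equal to row [i + 1], so only the last row
    contributes. *)
Lemma is_derive_gwr_id p (v : 'I_p.+1 -> K -> K) z :
  (forall j, smooth_at z (v j)) ->
  is_derive z 1 (fun t => \det (gwr id v t)) (\det (gwr (incr id p) v z)).
Proof.
move=> vz; have H := is_derive_gwr id vz; apply: is_derive_eq.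
rewrite big_ord_recr /= big1 ?add0r // => i _.
apply: (@gwr_dup _ _ _ _ (widen_ord (leqnSn p) i) (lift ord0 i)).
  by rewrite -(inj_eq val_inj) /= /bump /= neq_ltn add1n ltnSn.
by rewrite /incr /= /bump /= eqxx add1n gtn_eqF // addn0 addn1.
Qed.

(** Rows [i < p - 1] again produce a repetition. The last row survives, and so does row [p - 1],
    raised to the missing order [p]; for [p = 0] there is no such row. *)
Lemma is_derive_gwr_incr p (v : 'I_p.+1 -> K -> K) z :
  (forall j, smooth_at z (v j)) ->
  is_derive z 1 (fun t => \det (gwr (incr id p) v t))
    (\det (gwr (incr (incr id p) p) v z) +
     if (0 < p)%N then \det (gwr (incr (incr id p) p.-1) v z) else 0).
Proof.
move=> vz; have H := is_derive_gwr (incr id p) vz; apply: is_derive_eq.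
rewrite big_ord_recr /= addrC; congr (_ + _).
case: p v vz {H} => [|p] v vz /=; first by rewrite big_ord0.
rewrite big_ord_recr /= big1 ?add0r // => i _.
pose i1 : 'I_p.+2 := widen_ord (leqnSn _) (widen_ord (leqnSn _) i).
pose i2 : 'I_p.+2 := widen_ord (leqnSn _) (lift ord0 i).
apply: (@gwr_dup _ _ _ _ i1 i2).
  by rewrite -(inj_eq val_inj) /= /bump /= neq_ltn add1n ltnSn.
rewrite /incr /= /bump /= eqxx add1n eqSS (gtn_eqF (ltnSn i)).
by rewrite (ltn_eqF (ltn_ord i)) (ltn_eqF (ltnW _)) ?ltnS // !addn0 addn1.
Qed.

(** * Bordered families, cofactors and Cramer's rule *)

(** [ext_fam] over an arbitrary [numFieldType]; the two are convertible over [R[i]]. *)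
Definition ext n (g : 'I_n -> K -> K) (u : K -> K) : 'I_n.+1 -> K -> K :=
  fun j => match unlift ord_max j with Some i => g i | None => u end.

Lemma smooth_at_ext n (g : 'I_n -> K -> K) u z :
  (forall i, smooth_at z (g i)) -> smooth_at z u ->
  forall j, smooth_at z (ext g u j).
Proof. by move=> gz uz j; rewrite /ext; case: unlift. Qed.

(** [u] sits in the deleted column, and [bump i] skips the deleted row. *)
Lemma cofactor_gwr_ext n s (g : 'I_n -> K -> K) u z (i : 'I_n.+1) :
  cofactor (gwr s (ext g u) z) i ord_max =
    (-1) ^+ (i + n) * \det (gwr (s \o bump i) g z).
Proof.
rewrite /cofactor; congr (_ * \det _); apply/matrixP => k j.
by rewrite !mxE /ext liftK.
Qed.

(** Multiply by the adjugate, whose column [l] consists of the cofactors along row [l]. *)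
Lemma cramer_cofactor n (M : 'M[K]_n) (c : 'cV[K]_n) (t : K) (l j : 'I_n) :
  M *m c = t *: delta_mx l 0 -> \det M * c j 0 = t * cofactor M l j.
Proof.
move=> Mc; have : \adj M *m (M *m c) = \det M *: c.
  by rewrite mulmxA mul_adj_mx mul_scalar_mx.
rewrite Mc -scalemxAr -colE => /matrixP/(_ j 0).
by rewrite !mxE => ->.
Qed.

Lemma eq_gwr n s s' (v : 'I_n -> K -> K) z :
  (forall i, (i < n)%N -> s i = s' i) -> gwr s v z = gwr s' v z.
Proof. by move=> ss; apply/matrixP => i j; rewrite !mxE ss. Qed.

(** The zero coordinate removes [u] from linear combinations of the bordered family. *)
Definition ext_col n (c : 'cV[K]_n) : 'cV[K]_n.+1 :=
  \col_j if unlift ord_max j is Some i then c i 0 else 0.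

(** For smooth [v], the value [h^(k)(z)] of the combination [h = \sum_j c_j v_j]. *)
Definition comb n (v : 'I_n -> K -> K) z (c : 'cV[K]_n) (k : nat) : K :=
  \sum_j derive1n k (v j) z * c j 0.

Lemma comb_ext n (g : 'I_n -> K -> K) u z (c : 'cV[K]_n) :
  comb (ext g u) z (ext_col c) = comb g z c.
Proof.
apply: funext => k; rewrite /comb big_ord_recr /= mxE unlift_none mulr0 addr0.
apply: eq_bigr => i _.
have -> : widen_ord (leqnSn n) i = lift ord_max i.
  exact/val_inj/esym/lift_max.
by rewrite mxE /ext liftK.
Qed.

Lemma gwr_mul_col n s (v : 'I_n -> K -> K) z (c : 'cV[K]_n) i :
  (gwr s v z *m c) i 0 = comb v z c (s i).
Proof. by rewrite mxE; apply: eq_bigr => j _; rewrite mxE. Qed.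

Lemma gwr_mul_col_last p s (v : 'I_p.+1 -> K -> K) z (c : 'cV[K]_p.+1) :
  (forall i, (i < p)%N -> comb v z c (s i) = 0) ->
  gwr s v z *m c = comb v z c (s p) *: delta_mx ord_max 0.
Proof.
move=> v0; apply/colP => i; rewrite gwr_mul_col !mxE eqxx andbT.
have [->|ni] := eqVneq i ord_max; first by rewrite mulr1.
rewrite mulr0 v0 // ltn_neqAle -ltnS ltn_ord andbT.
by apply: contraNneq ni => ip; apply/eqP/val_inj.
Qed.

Lemma gwr_annihilator p (g : 'I_p.+1 -> K -> K) z :
  \det (gwr id g z) = 0 -> \det (gwr (incr id p) g z) != 0 ->
  exists gamma, forall u,
    \det (gwr (incr id p.+1) (ext g u) z) +
      gamma * \det (gwr id (ext g u) z) = 0.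
Proof.
move=> w0 w1.
(* The transpose turns the row vector supplied by [det0P] into a column killed by the matrix
   itself. *)
have /eqP/det0P[v v0 vM] : \det (gwr id g z)^T = 0 by rewrite det_tr.
have cM : gwr id g z *m v^T = 0 by apply: trmx_inj; rewrite trmx_mul trmxK trmx0.
have /rV0Pn[j vj] := v0.
set c := v^T in cM; have cj : c j 0 != 0 by rewrite mxE.
have h0 k : (k < p.+1)%N -> comb g z c k = 0.
  by move=> kp; rewrite -[k]/(val (Ordinal kp)) -(gwr_mul_col id) cM mxE.
have incrE n k : (k < n)%N -> incr id n k = k.
  by move=> kn; rewrite /incr ltn_eqF ?addn0.
have incrn n : incr id n n = n.+1 by rewrite /incr eqxx addn1.
have h1 : comb g z c p.+1 != 0.
  (* If [h^(p+1)(z)] vanished as well, Cramer's rule would force the determinant that represents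
     [w'] to be zero. *)
  apply: contraNneq w1 => h1.
  have Dc : gwr (incr id p) g z *m c =
      comb g z c (incr id p p) *: delta_mx ord_max 0.
    by apply: gwr_mul_col_last => i ip; rewrite incrE // h0 // ltnW.
  have /eqP := cramer_cofactor j Dc.
  by rewrite incrn h1 mul0r mulf_eq0 (negbTE cj) orbF.
(* Minus the quotient [h^(m+1) / h^(m)], with [m = p.+1]. *)
exists (- (comb g z c p.+2 / comb g z c p.+1)) => u.
pose cx := ext_col c; pose j' := lift ord_max j.
have cxj : cx j' 0 = c j 0 by rewrite /cx /j' mxE liftK.
have A : \det (gwr id (ext g u) z) * c j 0 = comb g z c p.+1 *
    cofactor (gwr id (ext g u) z) ord_max j'.
  rewrite -cxj -(comb_ext g u); apply: cramer_cofactor.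
  by apply: gwr_mul_col_last => i ip; rewrite comb_ext h0.
have B : \det (gwr (incr id p.+1) (ext g u) z) * c j 0 = comb g z c p.+2 *
    cofactor (gwr (incr id p.+1) (ext g u) z) ord_max j'.
  have -> : comb g z c p.+2 = comb g z c (incr id p.+1 p.+1) by rewrite incrn.
  rewrite -cxj -(comb_ext g u); apply: cramer_cofactor.
  by apply: gwr_mul_col_last => i ip; rewrite comb_ext incrE // h0.
(* The two matrices differ only in the last row, which these cofactors delete. *)
have AB : cofactor (gwr (incr id p.+1) (ext g u) z) ord_max j' =
    cofactor (gwr id (ext g u) z) ord_max j'.
  rewrite /cofactor; congr (_ * \det _); apply/matrixP => k l.
  by rewrite !mxE lift_max incrE.
apply: (mulIf cj); rewrite mul0r mulrDl B -mulrA A AB.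
by field.
Qed.

(** * Testing with powers of [z - x] *)

(** For [k > p] the falling factorial is zero, so the truncated exponent [p - k] does no harm. *)
Lemma derive1n_subX p k x :
  derive1n k (fun z : K => (z - x) ^+ p) =
  (fun z => (p ^_ k)%:R * (z - x) ^+ (p - k)).
Proof.
elim: k => [|k IH].
  by apply: funext => z; rewrite ffactn0 mul1r subn0.
rewrite derive1nS IH; apply: funext => z; rewrite derive1E.
have D : is_derive z 1 (fun z : K => z - x) 1.
  by have := is_deriveB (is_derive_id z 1) (is_derive_cst x z 1); rewrite subr0.
have DX := is_deriveZ (p ^_ k)%:R (is_deriveX (p - k) D).
rewrite exprfctE in DX; rewrite [LHS](@derive_val _ _ _ _ _ _ _ DX).
by rewrite -![_ *: _]/(_ * _) mulr1 mulrA -natrM ffactnSr subnS.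
Qed.

Lemma derive1n_subX_center p k x :
  derive1n k (fun z : K => (z - x) ^+ p) x = if k == p then p`!%:R else 0.
Proof.
rewrite derive1n_subX subrr expr0n subn_eq0.
case: ltngtP => [pk|kp|->]; first by rewrite ffact_small // mul0r.
  by rewrite mulr0.
by rewrite ffactnn mulr1.
Qed.

(* Testing with [(z - x) ^ p], whose only nonzero derivative at [x] is the one
   of order [p], isolates the coefficient of that derivative. *)
Lemma det_gwr_ext_subX p s (g : 'I_p.+1 -> K -> K) x :
  (forall i, (i < p.+2)%N -> (s i == p) = (i == p)) ->
  \det (gwr s (ext g (fun z => (z - x) ^+ p)) x) =
    - (p`!%:R * \det (gwr (s \o bump p) g x)).
Proof.
move=> sp; pose i0 : 'I_p.+2 := inord p.
have i0E : i0 = p :> nat by rewrite inordK // ltnS.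
rewrite (expand_det_col _ ord_max) (bigD1 i0) //= big1 ?addr0 => [|i ii0].
  (* The cofactor sign is [(-1)^(p + p + 1) = -1]. *)
  rewrite cofactor_gwr_ext mxE /ext unlift_none derive1n_subX_center sp //.
  rewrite i0E eqxx addnS exprS exprD -expr2 sqrr_sign mulr1.
  by rewrite mulN1r mulrN.
rewrite mxE /ext unlift_none derive1n_subX_center sp //.
suff /negbTE-> : val i != p by rewrite mul0r.
by rewrite -[X in _ != X]i0E (inj_eq val_inj).
Qed.

End GeneralizedWronskian.

(** * Application to the operator [Q] *)

Lemma derive1_eq (K : numFieldType) (f : K -> K) (z d : K) :
  is_derive z 1 f d -> derive1 f z = d.
Proof. by move=> H; rewrite derive1E derive_val. Qed.

Lemma near_smooth_family (K : numFieldType) n (v : 'I_n -> K -> K) (x : K) :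
  (forall i, \forall z \near x, smooth_at z (v i)) ->
  \forall z \near x, forall i, smooth_at z (v i).
Proof. exact: (@filter_forall _ _ (fun i z => smooth_at z (v i)) (nbhs x)). Qed.

Lemma analytic_near_subX (R : realType) (p : nat) (lam : CC R) :
  analytic_near (fun z : CC R => (z - lam) ^+ p) lam.
Proof.
exists 1; split=> //; exists (fun k => (k == p)%:R) => z _.
apply: (@numField_cvgn (CC R)) => e e0; exists p.+1 => // n /= pn.
rewrite big_mkord (bigD1 (Ordinal pn)) //= eqxx mul1r big1 => [|i ip].
  by rewrite addr0 subrr normr0.
suff /negbTE-> : val i != p by rewrite mul0r.
by rewrite -[X in _ != X]/(val (Ordinal pn)) (inj_eq val_inj).
Qed.

Lemma QopE (R : realType) m (g : 'I_m -> CC R -> CC R) u :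
  Qop g u = fun z => \det (gwr id (ext g u) z).
Proof. by []. Qed.

(** Identifies [v] with the second summand of [w''] in [is_derive_gwr_incr]: removing order [m - 2]
    from 0,...,m leaves exactly those rows, and the cofactor sign is even. *)
Lemma vcoefE (R : realType) p (g : 'I_p.+1 -> CC R -> CC R) z :
  vcoef g z =
    if (0 < p)%N then \det (gwr (incr (incr id p) p.-1) g z) else 0.
Proof.
rewrite /vcoef; case: p g => [|p] g //=.
rewrite /Qcoef subSS subn1 /=.
case: ltnP => [hp|]; last by rewrite ltnNge -ltnS ltnS leqW.
rewrite -[Wr _ z]/(gwr id (ext g (fun=> 0)) z) cofactor_gwr_ext /=.
rewrite !addnS exprS exprS mulrA -expr2 sqrrN expr1n mul1r.
rewrite exprD -expr2 sqrr_sign mul1r; congr (\det _); apply: eq_gwr => k kp.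
rewrite /bump /incr /= addnC.
by rewrite leq_eqVlt eq_sym; case: (ltngtP k p) => //; lia.
Qed.

Unset Implicit Arguments.

Theorem mainTheorem10 (R : realType) (m : nat) (g : 'I_m -> CC R -> CC R)
  (lam : CC R) :
  (forall i, analytic_near (g i) lam) ->
  wronskian g lam = 0 ->
  derive1 (wronskian g) lam != 0 ->
  let cond := fun gamma : CC R =>
    forall u : CC R -> CC R, analytic_near u lam ->
      derive1 (Qop g u) lam + gamma * Qop g u lam = 0 in
  (exists! gamma : CC R, cond gamma) /\
  (forall gamma : CC R, cond gamma ->
     gamma = (vcoef g lam - derive1n 2 (wronskian g) lam)
               / derive1 (wronskian g) lam).
Proof.
(* For [m = 0] the Wronskian is the empty determinant 1, contradicting [w0]. *)
case: m g => [|p] g ga w0 w1 cond.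
  by move: w0; rewrite /wronskian det_mx00 => /eqP; rewrite oner_eq0.
have gs : \forall z \near lam, forall i, smooth_at z (g i).
  apply: (@near_smooth_family (CC R)) => i.
  exact: (analytic_near_derivable (ga i)).
have gl := nbhs_singleton gs.
have dw z : (forall i, smooth_at z (g i)) ->
    derive1 (wronskian g) z = \det (gwr (incr id p) g z).
  by move=> gz; exact: derive1_eq (is_derive_gwr_id gz).
have ddw : derive1n 2 (wronskian g) lam =
    \det (gwr (incr (incr id p) p) g lam) + vcoef g lam.
  rewrite vcoefE -(derive1_eq (is_derive_gwr_incr gl)) derive1nS !derive1E.
  (* Differentiating [w'] again requires its determinant formula on a neighbourhood of [lam]. *)
  by apply: near_eq_derive; near=> z; apply: dw; near: z.
have dQ u : analytic_near u lam ->
    derive1 (Qop g u) lam = \det (gwr (incr id p.+1) (ext g u) lam).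
  move=> ua; have us := nbhs_singleton (analytic_near_derivable ua).
  exact: (derive1_eq (is_derive_gwr_id (smooth_at_ext gl us))).
have formula gamma : cond gamma ->
    gamma = (vcoef g lam - derive1n 2 (wronskian g) lam)
              / derive1 (wronskian g) lam.
  (* For [u = (z - lam)^p] with [p = m - 1], [Qu] and [(Qu)'] at [lam] are [- p!] times [w'] and
     [w'' - v], so [cond] becomes [w'' - v + gamma w' = 0]. *)
  have ua := analytic_near_subX p lam.
  move=> /(_ _ ua); rewrite dQ // QopE !det_gwr_ext_subX //; last first.
    move=> i ip; rewrite /incr; lia.
  have -> : gwr (incr id p.+1 \o bump p) g lam = gwr (incr (incr id p) p) g lam.
    by apply: eq_gwr => i ip; rewrite /incr /bump /=; lia.
  have -> : gwr (id \o bump p) g lam = gwr (incr id p) g lam.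
    by apply: eq_gwr => i ip; rewrite /incr /bump /=; lia.
  rewrite -(dw _ gl) mulrN -opprD mulrCA -mulrDr => /eqP.
  rewrite oppr_eq0 mulf_eq0 pnatr_eq0 (gtn_eqF (fact_gt0 p)) => /eqP H.
  apply: (mulIf w1); rewrite mulfVK // ddw opprD addrCA subrr addr0.
  by apply/eqP; rewrite -addr_eq0 addrC H.
split=> //.
(* Existence comes from the annihilator; uniqueness follows from [formula]. *)
have := gwr_annihilator w0; rewrite -(dw _ gl) => /(_ w1) [gamma Hg].
have cg : cond gamma by move=> u ua; rewrite dQ // Hg.
by exists gamma; split=> // gamma' cg'; rewrite (formula _ cg) (formula _ cg').
Unshelve. all: by end_near. Qed.
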